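(* For any graph $G$, $dom^+_{maj}(G)\leq \gamma_{maj}(G)$.
   Context: Graphs are finite, without loops or multiple edges. For a graph $G=(V,E)$, $N[v]$ denotes the closed neighborhood of $v$; for $f:V\to\{-1,1\}$ and $X\subseteq V$, $f(X)=\sum_{v\in X}f(v)$. A majority dominating function of $G$ is $f:V\to\{-1,1\}$ with $|\{v\in V: f(N[v])\geq1\}|\geq|V|/2$; its weight is $f(V)$; $\gamma_{maj}(G)$ is the minimum weight of a majority dominating function of $G$. For a digraph $D=(V,A)$, $N^+[u]=\{u\}\cup\{v: uv\in A\}$; a majority out-dominating function (MODF) of $D$ is $f:V\to\{-1,1\}$ with $|\{v: f(N^+[v])\geq1\}|\geq|V|/2$, and $\gamma^+_{maj}(D)$ is the minimum weight $f(V)$ of a MODF. An orientation of $G$ is a digraph obtained by replacing each edge $uv$ by exactly one of the arcs $uv$, $vu$. $dom^+_{maj}(G)$ is the minimum of $\gamma^+_{maj}(D)$ over all orientations $D$ of $G$. *)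

(* Defs.v *)
From HB Require Import structures.
From mathcomp Require Import all_boot all_order all_algebra.

Set Implicit Arguments.
Unset Strict Implicit.
Unset Printing Implicit Defensive.

Import Order.TTheory GRing.Theory Num.Theory.
Local Open Scope ring_scope.

Record sgraph := SGraph {
  vertex :> finType;
  adj : rel vertex;
  adj_sym : symmetric adj;
  adj_irrefl : irreflexive adj
}.

Definition pm1 : finType := seq_sub [:: -1; 1 : int].

Definition pm1_one : pm1 := @SeqSub _ [:: -1; 1 : int] 1 isT.

Section Functions.
Variable T : finType.

Definition sum_on (f : {ffun T -> pm1}) (X : {set T}) : int :=
  \sum_(v in X) val (f v).

Definition weight (f : {ffun T -> pm1}) : int := sum_on f [set: T].

(* |{v : f(N v) >= 1}| >= |V| / 2, where N v is the (closed or closed out-)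
   neighborhood of v. *)
Definition majority (N : T -> {set T}) (f : {ffun T -> pm1}) : bool :=
  (#|T| <= 2 * #|[set v | (1 <= sum_on f (N v))%R]|)%N.

Definition const1 : {ffun T -> pm1} := [ffun=> pm1_one].

Lemma sum_on_const1 X : sum_on const1 X = #|X|%:Z.
Proof.
by rewrite /sum_on (eq_bigr (fun=> 1)) ?sumr_const ?pmulrn ?intz // => v _;
  rewrite ffunE.
Qed.

Lemma majority_const1 (N : T -> {set T}) :
  (forall v, v \in N v) -> majority N const1.
Proof.
move=> Nv; rewrite /majority (_ : [set v | _] = setT) ?cardsT ?leq_pmull //.
apply/setP=> v; rewrite !inE sum_on_const1 lez_nat.
by apply/card_gt0P; exists v.
Qed.

(* A digraph on the vertex set T is given by its set of arcs. *)
Definition closed_out_nbh (D : {set T * T}) (u : T) : {set T} :=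
  u |: [set v | (u, v) \in D].

Definition is_modf (D : {set T * T}) (f : {ffun T -> pm1}) : bool :=
  majority (closed_out_nbh D) f.

Lemma is_modf_const1 D : is_modf D const1.
Proof. by apply: majority_const1 => v; rewrite !inE eqxx. Qed.

(* const1 only serves as a witness that the set minimized over is nonempty. *)
Definition gamma_maj_out (D : {set T * T}) : int :=
  weight [arg min_(f < const1 | is_modf D f) weight f]%O.

Lemma gamma_maj_outP D :
  (exists2 f, is_modf D f & weight f = gamma_maj_out D) /\
  (forall f, is_modf D f -> gamma_maj_out D <= weight f).
Proof.
rewrite /gamma_maj_out; case: arg_minP => [|f Df minf].
  exact: is_modf_const1.
by split=> //; exists f.
Qed.

End Functions.

Section Graph.
Variable G : sgraph.

Definition closed_nbh (v : G) : {set G} := v |: [set u | adj v u].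

Definition is_mdf (f : {ffun G -> pm1}) : bool := majority closed_nbh f.

Lemma is_mdf_const1 : is_mdf (const1 G).
Proof. by apply: majority_const1 => v; rewrite !inE eqxx. Qed.

Definition gamma_maj : int :=
  weight [arg min_(f < const1 G | is_mdf f) weight f]%O.

Lemma gamma_majP :
  (exists2 f, is_mdf f & weight f = gamma_maj) /\
  (forall f, is_mdf f -> gamma_maj <= weight f).
Proof.
rewrite /gamma_maj; case: arg_minP => [|f Gf minf]; first exact: is_mdf_const1.
by split=> //; exists f.
Qed.

Definition is_orientation (D : {set G * G}) : bool :=
  [forall u : G, forall v : G,
    if adj u v then ((u, v) \in D) (+) ((v, u) \in D) else (u, v) \notin D].

Definition rank_orientation : {set G * G} :=
  [set a | adj a.1 a.2 && (enum_rank a.1 < enum_rank a.2)%N].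

Lemma rank_orientationP : is_orientation rank_orientation.
Proof.
apply/forallP=> u; apply/forallP=> v; rewrite !inE /= [adj v u]adj_sym.
case: ifP => uv; rewrite uv //=.
have neq_uv : enum_rank u != enum_rank v :> nat.
  apply/eqP=> /val_inj/enum_rank_inj eq_uv.
  by rewrite eq_uv adj_irrefl in uv.
by move: neq_uv; rewrite neq_ltn; case: ltngtP.
Qed.

(* rank_orientation only serves as a witness that G has an orientation. *)
Definition dom_maj_out : int :=
  gamma_maj_out
    [arg min_(D < rank_orientation | is_orientation D) gamma_maj_out D]%O.

Lemma dom_maj_outP :
  (exists2 D, is_orientation D & gamma_maj_out D = dom_maj_out) /\
  (forall D, is_orientation D -> dom_maj_out <= gamma_maj_out D).
Proof.
rewrite /dom_maj_out; case: arg_minP => [|D oD minD].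
  exact: rank_orientationP.
by split=> //; exists D.
Qed.

End Graph.

(* Main.v *)
(** Let [f] be a majority dominating function and orient every edge between the
    vertices of value [-1] and those of value [1] towards the latter. A vertex of
    value [1] then has out-neighbours of value [1] only, while a vertex of value
    [-1] loses only neighbours of value [-1] from its closed neighbourhood. Hence
    every [v] with [f(N[v]) >= 1] has [f(N^+[v]) >= 1], and [f] itself is a
    majority out-dominating function of this orientation. *)

Require Import Defs.
From mathcomp Require Import all_boot all_order all_algebra.
Import Order.TTheory GRing.Theory Num.Theory.
Local Open Scope ring_scope.

Lemma pm1P (x : pm1) : val x = -1 \/ val x = 1.
Proof. by have := valP x; rewrite !inE => /orP[]/eqP; [left | right]. Qed.

Lemma majority_mono (T : finType) (N N' : T -> {set T}) (f : {ffun T -> pm1}) :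
  (forall v, 1 <= sum_on f (N v) -> 1 <= sum_on f (N' v)) ->
  majority N f -> majority N' f.
Proof.
move=> NN' /leq_trans; apply; rewrite leq_mul2l /=.
by apply/subset_leq_card/subsetP => v; rewrite !inE; apply: NN'.
Qed.

Section UpwardOrientation.
Variables (G : sgraph) (f : {ffun G -> pm1}).

(* Ties are broken by an arbitrary enumeration of the vertices. *)
Definition upward_orientation : {set G * G} :=
  [set a | adj a.1 a.2 &&
    ((val (f a.1) < val (f a.2)) ||
     (val (f a.1) == val (f a.2)) && (enum_rank a.1 < enum_rank a.2)%N)].

Lemma upward_orientationP : is_orientation upward_orientation.
Proof.
apply/forallP=> u; apply/forallP=> v; rewrite !inE /= [adj v u]adj_sym.
case: ifP => uv; rewrite uv //=.
(* Only the tie survives; there [u] and [v] differ because [adj] is irreflexive, so their ranks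
   decide the direction. *)
case: (ltgtP (val (f u)) (val (f v))) => //= _.
have neq_uv : enum_rank u != enum_rank v :> nat.
  apply/eqP=> /val_inj/enum_rank_inj eq_uv.
  by rewrite eq_uv adj_irrefl in uv.
by move: neq_uv; rewrite neq_ltn; case: ltngtP.
Qed.

Lemma upward_sum_pos (v : G) : val (f v) = 1 ->
  1 <= sum_on f (closed_out_nbh upward_orientation v).
Proof.
(* The vertex [v] alone supplies the required 1, so the other terms need only be nonnegative. *)
move=> fv; rewrite /sum_on (bigD1 v) ?inE ?eqxx //= fv lerDl.
apply: sumr_ge0 => u /andP[]; rewrite !inE /= => /orP[/eqP-> /eqP//|].
case/andP=> _ + _; rewrite fv.
by case: (pm1P (f u)) => ->.
Qed.

Lemma upward_sum_neg (v : G) : val (f v) = -1 ->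
  sum_on f (closed_nbh v) <= sum_on f (closed_out_nbh upward_orientation v).
Proof.
move=> fv; rewrite /sum_on (big_setID (closed_out_nbh upward_orientation v)) /=.
have /setIidPr -> : closed_out_nbh upward_orientation v \subset closed_nbh v.
  by apply/subsetP=> u; rewrite !inE /= => /orP[->//|/andP[-> _]]; rewrite orbT.
(* What is left is the sum over the lost neighbours; one of value 1 would be an out-neighbour, since
   [-1 < 1]. *)
rewrite gerDl; apply: sumr_le0 => u; rewrite !inE /= fv.
by case: (pm1P (f u)) => -> //; case: (u == v); case: (adj v u).
Qed.

Lemma is_modf_upward : is_mdf f -> is_modf upward_orientation f.
Proof.
apply: majority_mono => v fNv; case: (pm1P (f v)) => fv.
  exact: le_trans fNv (upward_sum_neg _ fv).
exact: upward_sum_pos.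
Qed.

End UpwardOrientation.

Theorem theorem4p10 (G : sgraph) : dom_maj_out G <= gamma_maj G.
Proof.
have [[f mdf_f <-] _] := gamma_majP G.
have [_ dom_min] := dom_maj_outP G.
apply: le_trans (dom_min _ (upward_orientationP G f)) _.
by have [_] := gamma_maj_outP (upward_orientation G f); apply; apply: is_modf_upward.
Qed.
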